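(* Let $S$ be a Clifford topological semigroup whose set of idempotents $E(S)$ is a $U$-semilattice. Then $S$ embeds topologically into $I_{\mathbb{N}}$ if and only if $S$ is Hausdorff, ditopological and every maximal subgroup of $S$, as well as the semilattice $E(S)$, embed topologically into $I_{\mathbb{N}}$.
   Context: An inverse semigroup is a semigroup $S$ such that for each $x\in S$ there is a unique $x^{-1}\in S$ with $xx^{-1}x=x$ and $x^{-1}xx^{-1}=x^{-1}$. It is Clifford if $xx^{-1}=x^{-1}x$ for all $x\in S$. A topological semigroup is a semigroup with a topology for which multiplication is continuous (such a topology is called a semigroup topology). A Clifford topological semigroup is a topological semigroup that is algebraically a Clifford semigroup. $E(S)=\{e\in S: e^2=e\}$ is a semilattice (commutative semigroup of idempotents). The maximal subgroups of $S$ are $H_e=\{x\in S: xx^{-1}=e=x^{-1}x\}$, $e\in E(S)$. $E(S)$ and the $H_e$ carry the subspace topology. For a semilattice $X$, write $x\le y$ if $xy=x$, and ${\uparrow}x=\{y\in X: x\le y\}$. A semilattice $X$ with a topology is a $U$-semilattice if for every open set $U$ and every $x\in U$ there exist $y\in U$ and an open neighbourhood $V$ of $x$ such that $V\subseteq{\uparrow}y$. An inverse semigroup $S$ with a semigroup topology is called ditopological if inversion is continuous and for any point $x\in S$ and any neighbourhood $O$ of $x$ there are neighbourhoods $U$ and $W$ of $x$ and $xx^{-1}$, respectively, such that $$\{s\in S : \exists b\in U,\ \exists e\in W\cap E(S)\text{ such that } b=es\}\cap\{s\in S : ss^{-1}\in W\}\subseteq O.$$ $I_{\mathbb{N}}$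 is the symmetric inverse monoid of all partial permutations of $\mathbb{N}$ (bijections between subsets of $\mathbb{N}$) under composition of binary relations (functions act on the right and compose from left to right), with the topology generated by the subbasis consisting of the sets $U_{x,y}=\{h : (x,y)\in h\}$, $W_x=\{h : x\notin\operatorname{dom}(h)\}$ and $W_x^{-1}=\{h : x\notin\operatorname{im}(h)\}$, for $x,y\in\mathbb{N}$. An embedding of semigroups is an injective homomorphism; an embedding $\phi:S\to T$ of topological semigroups is topological if both $\phi$ and $\phi^{-1}:(S)\phi\to S$ are continuous, where $(S)\phi$ has the subspace topology. ''$S$ embeds topologically into $T$'' means such a topological embedding exists. *)

(* Defs.v *)
From HB Require Import structures.
From mathcomp Require Import all_boot.
From mathcomp Require Import all_classical.
From mathcomp Require Import topology.

Set Implicit Arguments.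
Unset Strict Implicit.
Unset Printing Implicit Defensive.

Local Open Scope classical_set_scope.
Local Open Scope group_scope.

HB.mixin Record Semigroup_isInverse S & Semigroup S := {
  sinv : S -> S;
  sinv_unique : forall x : S,
    unique (fun y => x * y * x = x /\ y * x * y = y) (sinv x)
}.

#[short(type="inverseSemigroupType")]
HB.structure Definition InverseSemigroup :=
  {S of Semigroup S & Semigroup_isInverse S}.

HB.mixin Record InverseSemigroup_isClifford S & InverseSemigroup S := {
  sinv_comm : forall x : S, x * sinv x = sinv x * x
}.

#[short(type="cliffordSemigroupType")]
HB.structure Definition CliffordSemigroup :=
  {S of InverseSemigroup S & InverseSemigroup_isClifford S}.

HB.mixin Record Semigroup_isSemilattice S & Semigroup S := {
  slmulC : forall x y : S, x * y = y * x;
  slmulxx : forall x : S, x * x = x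
}.

#[short(type="semilatticeSemigroupType")]
HB.structure Definition SemilatticeSemigroup :=
  {S of Semigroup S & Semigroup_isSemilattice S}.

(* A semigroup with an arbitrary topology, unrelated to the product. *)
#[short(type="preTopologicalSemigroupType")]
HB.structure Definition PreTopologicalSemigroup :=
  {S of Topological S & Semigroup S}.

#[short(type="preTopologicalSemilatticeType")]
HB.structure Definition PreTopologicalSemilattice :=
  {S of Topological S & SemilatticeSemigroup S}.

HB.mixin Record PreTopologicalSemigroup_isTopological S
    & PreTopologicalSemigroup S := {
  smul_continuous : continuous (fun xy : S * S => xy.1 * xy.2)
}.

#[short(type="topologicalSemigroupType")]
HB.structure Definition TopologicalSemigroup :=
  {S of PreTopologicalSemigroup S & PreTopologicalSemigroup_isTopological S}.

(* Inversion is not required to be continuous in the next two structures. *)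
#[short(type="inverseTopologicalSemigroupType")]
HB.structure Definition InverseTopologicalSemigroup :=
  {S of TopologicalSemigroup S & InverseSemigroup S}.

#[short(type="cliffordTopologicalSemigroupType")]
HB.structure Definition CliffordTopologicalSemigroup :=
  {S of TopologicalSemigroup S & CliffordSemigroup S}.

Record subsemigroup (S : semigroupType) := Subsemigroup {
  subsemigroup_set :> set S;
  subsemigroupM : forall x y : S,
    subsemigroup_set x -> subsemigroup_set y -> subsemigroup_set (x * y)
}.

Definition subsemigroup_type (S : semigroupType) (A : subsemigroup S) : Type :=
  set_type A.

Section SubsemigroupType.
Variables (S : semigroupType) (A : subsemigroup S).
Local Notation T := (subsemigroup_type A).

Definition subsemigroup_mul (x y : T) : T :=
  SigSub (mem_set (subsemigroupM (set_valP x) (set_valP y))).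

Lemma subsemigroup_mulA : associative subsemigroup_mul.
Proof. by move=> x y z; apply: val_inj; rewrite /= mulgA. Qed.

HB.instance Definition _ := Choice.on T.
HB.instance Definition _ := isSemigroup.Build T subsemigroup_mulA.

End SubsemigroupType.

(* The topology of [set_type] is the subspace topology. *)
HB.instance Definition _ (S : preTopologicalSemigroupType)
  (A : subsemigroup S) := Topological.copy (subsemigroup_type A) (set_type A).

Section InverseSemigroupTheory.
Variable S : inverseSemigroupType.
Implicit Types x y e f : S.

Lemma mulgVKs x : x * sinv x * x = x.
Proof. by have [[]] := sinv_unique x. Qed.

Lemma mulVgKs x : sinv x * x * sinv x = sinv x.
Proof. by have [[]] := sinv_unique x. Qed.

Lemma sinv_eq x y : x * y * x = x -> y * x * y = y -> sinv x = y.
Proof. by move=> xyx yxy; have [_] := sinv_unique x; apply. Qed.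

Lemma sinv_idem e : e * e = e -> sinv e = e.
Proof. by move=> ee; apply: sinv_eq; rewrite !ee. Qed.

Lemma sinvK x : sinv (sinv x) = x.
Proof. by apply: sinv_eq; [exact: mulVgKs | exact: mulgVKs]. Qed.

Lemma idemM e f : e * e = e -> f * f = f -> e * f * (e * f) = e * f.
Proof.
move=> ee ff; set x := sinv (e * f).
have h1 : e * f * x * e * f = e * f.
  by have := mulgVKs (e * f); rewrite -/x !mulgA.
have h2 : x * e * f * x = x by have := mulVgKs (e * f); rewrite -/x !mulgA.
have xE : x = f * x * e.
  apply: sinv_eq.
    by rewrite !mulgA -(mulgA e f f) ff -(mulgA _ e e) ee h1.
  rewrite !mulgA -(mulgA _ e e) ee -(mulgA _ f f) ff.
  by congr (_ * _); rewrite -!mulgA; congr (_ * _); rewrite !mulgA.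
have xx : x * x = x.
  rewrite {1 2}xE [RHS]xE !mulgA; congr (_ * _).
  by rewrite -!mulgA; congr (_ * _); rewrite !mulgA.
have -> : e * f = x by rewrite -(sinvK (e * f)) -/x sinv_idem.
by [].
Qed.

Lemma idemC e f : e * e = e -> f * f = f -> e * f = f * e.
Proof.
move=> ee ff; rewrite -(sinv_idem (idemM ee ff)); apply: sinv_eq.
  by rewrite !mulgA -(mulgA e f f) ff -(mulgA _ e e) ee -mulgA idemM.
by rewrite !mulgA -(mulgA f e e) ee -(mulgA _ f f) ff -mulgA idemM.
Qed.

Lemma idem_mulgV x : x * sinv x * (x * sinv x) = x * sinv x.
Proof. by rewrite mulgA mulgVKs. Qed.

Lemma idem_mulVg x : sinv x * x * (sinv x * x) = sinv x * x.
Proof. by rewrite mulgA mulVgKs. Qed.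

Lemma sinvM x y : sinv (x * y) = sinv y * sinv x.
Proof.
have C := idemC (idem_mulgV y) (idem_mulVg x).
apply: sinv_eq.
  transitivity (x * (y * sinv y * (sinv x * x)) * y); first by rewrite !mulgA.
  by rewrite C !mulgA mulgVKs -!mulgA (mulgA y) mulgVKs.
transitivity (sinv y * (sinv x * x * (y * sinv y)) * sinv x).
  by rewrite !mulgA.
by rewrite -C !mulgA mulVgKs -!mulgA (mulgA (sinv x)) mulVgKs.
Qed.

End InverseSemigroupTheory.

Definition idempotent_set (S : semigroupType) : set S := [set e | e * e = e].
Arguments idempotent_set S : clear implicits.

Section Substructures.
Variable S : inverseSemigroupType.

Definition idempotents : subsemigroup S :=
  @Subsemigroup S (idempotent_set S) (@idemM S).

Lemma maximal_subgroupM (e x y : S) :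
  x * sinv x = e /\ e = sinv x * x -> y * sinv y = e /\ e = sinv y * y ->
  x * y * sinv (x * y) = e /\ e = sinv (x * y) * (x * y).
Proof.
move=> [xe ex] [ye ey]; rewrite sinvM; split.
  by rewrite !mulgA -(mulgA x y) ye ex mulgA mulgVKs xe.
by rewrite !mulgA -(mulgA _ _ x) -ex -ye mulgA mulVgKs -ey.
Qed.

(* For [e] not idempotent this is the empty semigroup. *)
Definition maximal_subgroup (e : S) : subsemigroup S :=
  @Subsemigroup S [set x | x * sinv x = e /\ e = sinv x * x]
    (@maximal_subgroupM e).

Definition idempotent_semilattice : Type := subsemigroup_type idempotents.

HB.instance Definition _ := Semigroup.on idempotent_semilattice.

Lemma idempotent_semilatticeC (e f : idempotent_semilattice) : e * f = f * e.
Proof. by apply: val_inj; exact: idemC (set_valP e) (set_valP f). Qed.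

Lemma idempotent_semilatticexx (e : idempotent_semilattice) : e * e = e.
Proof. by apply: val_inj; exact: (set_valP e). Qed.

HB.instance Definition _ := Semigroup_isSemilattice.Build
  idempotent_semilattice idempotent_semilatticeC idempotent_semilatticexx.

End Substructures.

HB.instance Definition _ (S : inverseTopologicalSemigroupType) :=
  Topological.copy (idempotent_semilattice S)
    (subsemigroup_type (idempotents S)).

Definition upset (X : semilatticeSemigroupType) (x : X) : set X :=
  [set y | x * y = x].

Definition U_semilattice (X : preTopologicalSemilatticeType) : Prop :=
  forall (U : set X) (x : X), open U -> U x ->
    exists y : X, U y /\ exists V : set X, open_nbhs x V /\ V `<=` upset y.

Definition ditopological (S : inverseTopologicalSemigroupType) : Prop :=
  continuous (@sinv S) /\
  forall (x : S) (O : set S), nbhs x O ->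
    exists U W : set S, [/\ nbhs x U, nbhs (x * sinv x) W &
      [set s | exists b, U b /\
         exists e, (W `&` idempotent_set S) e /\ b = e * s]
      `&` [set s | W (s * sinv s)] `<=` O].

(* The last component says that the inverse of [phi] is continuous on the image
   of [phi] with the subspace topology. *)
Definition topological_embedding (S T : preTopologicalSemigroupType)
    (phi : S -> T) : Prop :=
  [/\ forall x y : S, phi (x * y) = phi x * phi y,
      injective phi,
      continuous phi &
      exists psi : set_type (range phi) -> S,
        (forall t, phi (psi t) = set_val t) /\ continuous psi].

Definition embeds_topologically (S T : preTopologicalSemigroupType) : Prop :=
  exists phi : S -> T, topological_embedding phi.

Record partial_perm := PartialPerm {
  pp_rel : set (nat * nat);
  pp_functional : forall x y z, pp_rel (x, y) -> pp_rel (x, z) -> y = z;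
  pp_injective : forall x y z, pp_rel (x, z) -> pp_rel (y, z) -> x = y
}.

Lemma pp_eq (g h : partial_perm) : pp_rel g = pp_rel h -> g = h.
Proof.
case: g h => [g gf gi] [h hf hi] /= gh; subst h.
by rewrite (Prop_irrelevance gf hf) (Prop_irrelevance gi hi).
Qed.

HB.instance Definition _ := gen_eqMixin partial_perm.
HB.instance Definition _ := gen_choiceMixin partial_perm.

(* Relational composition from left to right: [x (g h) z] iff [x g y] and
   [y h z] for some [y]. *)
Definition pp_comp (g h : partial_perm) : partial_perm.
Proof.
exists [set xz : nat * nat | exists y,
  pp_rel g (xz.1, y) /\ pp_rel h (y, xz.2)] => x y z.
  by move=> /= [u [xu uy]] [v [xv]]; rewrite -(pp_functional xu xv);
    exact: pp_functional uy.
move=> /= [u [xu uz]] [v [yv vz]]; rewrite -(pp_injective uz vz) in yv.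
exact: pp_injective xu yv.
Defined.

Lemma pp_compA : associative pp_comp.
Proof.
move=> f g h; apply: pp_eq; apply/seteqP; split=> -[x z] /=.
  by move=> [y [fxy [u [gyu huz]]]]; exists u; split=> //; exists y.
by move=> [u [[y [fxy gyu]] huz]]; exists y; split=> //; exists u.
Qed.

HB.instance Definition _ := isSemigroup.Build partial_perm pp_compA.

Definition pp_dom (h : partial_perm) : set nat :=
  [set x | exists y, pp_rel h (x, y)].

Definition pp_im (h : partial_perm) : set nat :=
  [set y | exists x, pp_rel h (x, y)].

Definition pp_subbasis : set (set partial_perm) :=
  [set A | [\/ exists x y : nat, A = [set h | pp_rel h (x, y)],
      exists x : nat, A = [set h | ~ pp_dom h x] |
      exists x : nat, A = [set h | ~ pp_im h x]]].

HB.instance Definition _ :=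
  isSubBaseTopological.Build partial_perm pp_subbasis id.

(* Main.v *)
Require Import Defs.
From HB Require Import structures.
From mathcomp Require Import all_boot.
From mathcomp Require Import all_classical.
From mathcomp Require Import topology.

(** Necessity holds because an inverse subsemigroup of the symmetric inverse
monoid is ditopological as soon as it is Clifford: [dom s] and [im s] both
coincide with the fixed points of [s * sinv s], so control of [s * sinv s]
controls missing images as well as missing arguments
([embeds_ditopological]).  The remaining necessary conditions are inherited by
subspaces.

For sufficiency, idempotent partial permutations are partial identities, so an
embedding of [E(S)] amounts to writing each idempotent [e] as a subset [D e] of
the natural numbers, with products going to intersections and with the topology
of finite conditions [a \in D e] or [a \notin D e].  For a finite [F] the set
[P F] of all [s] with [F] inside [D (s * sinv s)] is clopen and its complement
is an ideal.  The point of the argument is that, in a U-semilattice, near any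
idempotent [e] lies an idempotent [y] that is a lower bound of some such
clopen filter containing [e]: if all idempotents satisfying finitely many
conditions at [e] lie above [y], let [F] collect the positive conditions; any
[f] in [P F] has [f * e] satisfying the negative conditions too, because
[D (f * e)] is inside [D e], and so [y <= f * e <= f].

For such [F] and [y], sending [s] in [P F] to [y * s] in the maximal subgroup
[H_y], and every other [s] to the empty permutation, is a continuous
representation of [S] ([maximal_subgroup_component]).  Idempotents being
central, it is multiplicative.  Only countably many pairs are used: one [y] for
each [F] and each basic open box of [E(S)].  Together with
[s |-> s * sinv s] these representations induce the topology of [S], since
ditopologicality recovers [s] near [x] from [y * s] near [x] and [s * sinv s]
near [x * sinv x].  Finally, a countable family of representations inducing a
Hausdorff topology combines into one embedding, by letting them act on the
blocks of a partition of the natural numbers ([embeds_countable_family]). *)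

Set Implicit Arguments.
Unset Strict Implicit.
Unset Printing Implicit Defensive.

Local Open Scope classical_set_scope.
Local Open Scope group_scope.

(** * The topology of the symmetric inverse monoid *)

(** The subbasic conditions on [h] at the point [a], as satisfied by [g], amount
to [h] having the same row and the same column as [g] at [a]. *)
Definition agree_at (g : partial_perm) (a : nat) : set partial_perm :=
  [set h | forall b, (pp_rel g (a, b) <-> pp_rel h (a, b)) /\
                     (pp_rel g (b, a) <-> pp_rel h (b, a))].

Lemma nbhs_agree_at g a : nbhs g (agree_at g a).
Proof.
have subO A : pp_subbasis A -> A g -> nbhs g A.
  move=> sA Ag; apply: open_nbhs_nbhs; split=> //.
  exists [set A]; last by rewrite bigcup_set1.
  by move=> _ ->; exact: finI_from1.
have nR : nbhs g [set h | forall b, pp_rel g (a, b) <-> pp_rel h (a, b)].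
  have [[b gab]|ga] := pselect (pp_dom g a).
    apply: filterS (subO [set h | pp_rel h (a, b)] _ gab).
      move=> h hab c; split=> [/(pp_functional gab) <-//|].
      by move=> /(pp_functional hab) <-.
    by constructor 1; exists a, b.
  apply: filterS (subO [set h | ~ pp_dom h a] _ ga).
    by move=> h ha c; split=> ac; [case: ga|case: ha]; exists c.
  by constructor 2; exists a.
have nC : nbhs g [set h | forall b, pp_rel g (b, a) <-> pp_rel h (b, a)].
  have [[b gba]|ga] := pselect (pp_im g a).
    apply: filterS (subO [set h | pp_rel h (b, a)] _ gba).
      move=> h hba c; split=> [/(pp_injective gba) <-//|].
      by move=> /(pp_injective hba) <-.
    by constructor 1; exists b, a.
  apply: filterS (subO [set h | ~ pp_im h a] _ ga).
    by move=> h ha c; split=> ca; [case: ga|case: ha]; exists c.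
  by constructor 3; exists a.
by apply: filterS (filterI nR nC) => h [hR hC] b; split; [exact: hR|exact: hC].
Qed.

Definition agree_on (F : seq nat) (g : partial_perm) : set partial_perm :=
  [set h | forall a, a \in F -> agree_at g a h].

Lemma filter_in_seq (T : Type) (I : eqType) (FF : set_system T)
    (P : I -> set T) (s : seq I) : Filter FF ->
  (forall i, FF (P i)) -> FF [set t | forall i, i \in s -> P i t].
Proof.
move=> FFF FP; elim: s => [|i s IHs].
  by apply: filterS filterT => t _ j; rewrite in_nil.
apply: filterS (filterI (FP i) IHs) => t [Pi Ps] j.
by rewrite inE => /predU1P[->//|]; exact: Ps.
Qed.

Lemma nbhs_agree_on (F : seq nat) g : nbhs g (agree_on F g).
Proof. exact: (filter_in_seq F _ (nbhs_agree_at g)). Qed.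

(** Hence the sets [agree_on F g], for finite [F], form a neighbourhood base at
[g]: each subbasic set around [g] is decided at a single point. *)
Lemma nbhs_ppP g (O : set partial_perm) : nbhs g O ->
  exists F : seq nat, agree_on F g `<=` O.
Proof.
rewrite nbhsE => -[_ [[BB sBB <-] [B BBB Bg]] BO].
have [D sD DB] := sBB _ BBB.
have {sD} : forall A, A \in finmap.enum_fset D -> pp_subbasis A /\ A g.
  move=> A AD; split; first by have := sD _ AD; rewrite inE.
  by move: Bg; rewrite -DB; apply.
suff sub (s : seq (set partial_perm)) :
    (forall A, A \in s -> pp_subbasis A /\ A g) ->
    exists F : seq nat, forall h, agree_on F g h -> forall A, A \in s -> A h.
  move=> /sub[F FD]; exists F => h /FD hD; apply: BO.
  by exists B => //; rewrite -DB.
elim: s => [_|A s IHs sA]; first by exists [::] => h _ A; rewrite in_nil.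
have [|F hF] := IHs; first by move=> B' Bs; apply: sA; rewrite inE Bs orbT.
have [a aA] : exists a, agree_at g a `<=` A.
  have [[[x [y ->]] gxy|[x ->] gx|[x ->] gx]] := sA A (mem_head _ _).
  - by exists x => h /(_ y)[[+ _] _]; apply.
  - by exists x => h hx [y /(hx y).1 hxy]; apply: gx; exists y.
  - by exists x => h hx [y /(hx y).2 hxy]; apply: gx; exists y.
exists (a :: F) => h haF B'; rewrite inE => /predU1P[->|].
  by apply: aA; apply: haF; exact: mem_head.
by apply: hF => b bF; apply: haF; rewrite inE bF orbT.
Qed.

Lemma pp_continuousP (T : topologicalType) (f : T -> partial_perm) :
  continuous f <-> forall t a, \forall s \near t, agree_at (f t) a (f s).
Proof.
split=> [cf t a|fP t O /nbhs_ppP[F FO]]; first exact/cf/nbhs_agree_at.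
apply: filterS (filter_in_seq F _ (fP t)) => s; exact: FO.
Qed.

Lemma hausdorff_partial_perm : hausdorff_space partial_perm.
Proof.
move=> g h gh; apply: pp_eq; apply/seteqP.
suff eqr a b : pp_rel g (a, b) <-> pp_rel h (a, b).
  by split=> -[a b] /eqr.
have [k [ka ha]] := gh _ _ (nbhs_agree_at g a) (nbhs_agree_at h a).
by have [-> _] := ka b; have [-> _] := ha b.
Qed.

(** * Topological embeddings and subspaces *)

Lemma nbhs_set_typeP (T : topologicalType) (A : set T) (t : A) (O : set A) :
  nbhs t O <-> exists2 V, nbhs (set_val t) V & set_val @^-1` V `<=` O.
Proof.
split=> [|[V Vt VO]]; last first.
  by apply: filterS VO _; exact: (initial_continuous (f:=set_val)).
rewrite (@nbhsE (set_type A)) => -[_ [[V oV <-] Vt] VO]; exists V => //.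
by apply: open_nbhs_nbhs; split.
Qed.

(** Replaces the inverse map on the image by a condition on neighbourhoods in
the source, which avoids working with the type of points of the image. *)
Lemma topological_embeddingP (S T : preTopologicalSemigroupType)
    (phi : S -> T) :
  topological_embedding phi <->
  [/\ {morph phi : x y / x * y}, injective phi, continuous phi &
      forall x O, nbhs x O -> exists2 V, nbhs (phi x) V & phi @^-1` V `<=` O].
Proof.
split=> -[phiM phiI phiC]; first move=> [psi [phiK psiC]].
  split=> // x O Ox.
  have rg y : range phi (phi y) by exists y.
  have psiK y : psi (SigSub (mem_set (rg y))) = y by apply: phiI; rewrite phiK.
  have /(_ O) := psiC (SigSub (mem_set (rg x))); rewrite psiK => /(_ Ox).
  move=> /nbhs_set_typeP[V Vx VO]; exists V => // y Vy.
  by rewrite -(psiK y); exact: VO.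
move=> phi_nbhs; split=> //.
have /choice[psi phiK] :
    forall t : set_type (range phi), exists x, phi x = set_val t.
  by move=> t; have [x _ xt] := set_valP t; exists x.
exists psi; split=> // t O /phi_nbhs[V Vt VO]; apply/nbhs_set_typeP.
by exists V; [rewrite phiK in Vt|move=> u Vu; apply: VO; rewrite /= phiK].
Qed.

Lemma embeds_subsemigroup (S T : preTopologicalSemigroupType)
    (A : subsemigroup S) :
  embeds_topologically S T -> embeds_topologically (subsemigroup_type A) T.
Proof.
move=> [phi /topological_embeddingP[phiM phiI phiC phi_nbhs]].
exists (phi \o set_val); apply/topological_embeddingP; split=> /=.
- by move=> x y; rewrite -phiM.
- by move=> x y /phiI; exact: val_inj.
- move=> x; apply: continuous_comp; last exact: phiC.
  exact: (@initial_continuous _ _ (set_val : subsemigroup_type A -> S)).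
- move=> x O /nbhs_set_typeP[V /phi_nbhs[W Wx WV] VO].
  by exists W => // y /WV; exact: VO.
Qed.

Lemma embeds_hausdorff (S T : preTopologicalSemigroupType) :
  embeds_topologically S T -> hausdorff_space T -> hausdorff_space S.
Proof.
move=> [phi [_ phiI phiC _]] hT x y xy; apply/phiI/hT => A B /phiC Ax /phiC By.
by have [z [Az Bz]] := xy _ _ Ax By; exists (phi z).
Qed.

(** * Clifford semigroups of partial permutations *)

Lemma pp_idem_diag (h : partial_perm) a b :
  h * h = h -> pp_rel h (a, b) -> a = b.
Proof.
move=> hh hab; have [c [/= hac hcb]] : pp_rel (h * h) (a, b) by rewrite hh.
by rewrite -(pp_functional hab hac) in hcb; exact: pp_injective hab hcb.
Qed.

Lemma pp_rel_inverse (g h : partial_perm) a b :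
  h * g * h = h -> pp_rel h (a, b) -> pp_rel g (b, a).
Proof.
move=> hgh hab.
have [c [/= [d [/= had gdc]] hcb]] : pp_rel (h * g * h) (a, b) by rewrite hgh.
by rewrite (pp_functional hab had) -(pp_injective hcb hab).
Qed.

Section Representation.
Variables (S : inverseSemigroupType) (phi : S -> partial_perm).
Hypothesis phiM : {morph phi : x y / x * y}.

Lemma pp_rel_sinv s a b :
  pp_rel (phi (sinv s)) (a, b) <-> pp_rel (phi s) (b, a).
Proof.
by split; apply: pp_rel_inverse; rewrite -!phiM (mulVgKs, mulgVKs).
Qed.

Lemma pp_dom_mulV s a :
  pp_dom (phi s) a <-> pp_rel (phi (s * sinv s)) (a, a).
Proof.
rewrite phiM; split=> [[b sab]|[b [/= sab _]]]; last by exists b.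
by exists b; split=> //=; apply/pp_rel_sinv.
Qed.

Lemma pp_im_mulV s a :
  pp_im (phi s) a <-> pp_rel (phi (sinv s * s)) (a, a).
Proof.
rewrite phiM; split=> [[b sba]|[b [/= _ sba]]]; last by exists b.
by exists b; split=> //=; apply/pp_rel_sinv.
Qed.

End Representation.

(** A restriction [e * s] that agrees with [x] on [F] only forces [s] to extend
[x] on the rows and columns of [F].  That [s] has no further rows there follows
from [s * sinv s] agreeing with [x * sinv x], and that it has no further columns
from [sinv_comm], which makes the same idempotent govern the image. *)
Lemma embeds_ditopological (S : cliffordTopologicalSemigroupType) :
  embeds_topologically S partial_perm -> ditopological S.
Proof.
move=> [phi /topological_embeddingP[phiM phiI phiC phi_nbhs]]; split.
  move=> x O /phi_nbhs[V /nbhs_ppP[F FV] VO].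
  have xF : nbhs x (phi @^-1` agree_on F (phi x)) by exact/phiC/nbhs_agree_on.
  rewrite nbhs_simpl; apply: filterS xF => y xy.
  apply/VO/FV => a /xy xya b; have [row col] := xya b.
  by split; split=> /(pp_rel_sinv phiM _ _ _).1 xyb;
    apply/(pp_rel_sinv phiM _ _ _).2; (apply/row || apply/col).
move=> x O /phi_nbhs[V /nbhs_ppP[F FV] VO].
exists (phi @^-1` agree_on F (phi x)),
  (phi @^-1` agree_on F (phi (x * sinv x))); split.
- exact/phiC/nbhs_agree_on.
- exact/phiC/nbhs_agree_on.
move=> s [[es [xes [e [[_ ee] esE]]]] xs]; subst es; apply/VO/FV => a aF b.
have diag c d : pp_rel (phi e) (c, d) -> c = d.
  by apply: pp_idem_diag; rewrite -phiM; congr phi; exact: ee.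
have row c : pp_rel (phi x) (a, c) -> pp_rel (phi s) (a, c).
  by move=> /(xes a aF c).1; rewrite phiM => -[d [/= /diag ->]].
have col c : pp_rel (phi x) (c, a) -> pp_rel (phi s) (c, a).
  by move=> /(xes a aF c).2; rewrite phiM => -[d [/= /diag ->]].
split; split; [exact: row|move=> sab|exact: col|move=> sba].
- have [c xac] : pp_dom (phi x) a.
    apply/(pp_dom_mulV phiM); apply/(xs a aF a).1.
    by apply/(pp_dom_mulV phiM); exists b.
  by rewrite (pp_functional sab (row _ xac)).
- have [c xca] : pp_im (phi x) a.
    apply/(pp_im_mulV phiM); rewrite -sinv_comm; apply/(xs a aF a).1.
    by rewrite sinv_comm; apply/(pp_im_mulV phiM); exists b.
  by rewrite (pp_injective sba (col _ xca)).
Qed.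

(** * Sums of countably many representations *)

(** The pairs [(i, a)], coded as natural numbers, form the block [i], on which
[f i] acts. *)
Definition pp_sum (I : countType) (f : I -> partial_perm) : partial_perm.
Proof.
exists [set mn | exists i a b,
  mn = (pickle (i, a), pickle (i, b)) /\ pp_rel (f i) (a, b)].
  move=> m n p [i [a [b [[-> ->] fab]]]] [j [c [d [[+ ->] fcd]]]].
  move=> /(pcan_inj pickleK)[ij ac]; subst j c.
  by rewrite (pp_functional fab fcd).
move=> m n p [i [a [b [[-> ->] fab]]]] [j [c [d [[-> +] fcd]]]].
move=> /(pcan_inj pickleK)[ij bd]; subst j d.
by rewrite (pp_injective fab fcd).
Defined.

Section Sum.
Variable I : countType.
Implicit Types f g : I -> partial_perm.

Lemma pp_sum_block f i a b :
  pp_rel (pp_sum f) (pickle (i, a), pickle (i, b)) <-> pp_rel (f i) (a, b).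
Proof.
split=> [[j [c [d [[+ +] fcd]]]]|fab]; last by exists i, a, b.
move=> /(pcan_inj pickleK)[ij ac] /(pcan_inj pickleK)[_ bd].
by subst j c d.
Qed.

Lemma pp_sumM f g : pp_sum (fun i => f i * g i) = pp_sum f * pp_sum g.
Proof.
apply: pp_eq; apply/seteqP; split=> -[m n] /=.
  move=> [i [a [b [[-> ->] [c [/= fac gcb]]]]]].
  by exists (pickle (i, c)); split; apply/pp_sum_block.
move=> [_ [[i [a [c [[-> ->] fac]]]] [j [d [b [[+ ->] gdb]]]]]].
move=> /(pcan_inj pickleK)[ij cd]; subst j d.
by exists i, a, b; split=> //; exists c.
Qed.

Lemma agree_at_sum f g i a :
  agree_at (pp_sum f) (pickle (i, a)) (pp_sum g) <-> agree_at (f i) a (g i).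
Proof.
split=> fg => [b|n].
  by have [row col] := fg (pickle (i, b)); split; split;
    (move=> /pp_sum_block/row/pp_sum_block) ||
    (move=> /pp_sum_block/col/pp_sum_block).
split; split=> -[j [c [d [[]]]]].
- move=> /(pcan_inj pickleK)[ij ac] -> fcd; subst j c.
  by apply/pp_sum_block; apply/(fg d).1.
- move=> /(pcan_inj pickleK)[ij ac] -> fcd; subst j c.
  by apply/pp_sum_block; apply/(fg d).1.
- move=> -> /(pcan_inj pickleK)[ij ad] fcd; subst j d.
  by apply/pp_sum_block; apply/(fg c).2.
- move=> -> /(pcan_inj pickleK)[ij ad] fcd; subst j d.
  by apply/pp_sum_block; apply/(fg c).2.
Qed.

Lemma agree_at_sum_out f g n :
  (forall (i : I) (a : nat), n <> pickle (i, a)) ->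
  agree_at (pp_sum f) n (pp_sum g).
Proof.
move=> nI m; split; split=> -[i [a [b [[n1 n2] _]]]];
  by [have := nI i a | have := nI i b].
Qed.

(** The finite lists [J] say that the topology of [S] is the one induced by the
representations [phi i]; such a topology, being Hausdorff, also forces them to
separate points. *)
Lemma embeds_countable_family (S : preTopologicalSemigroupType)
    (phi : I -> S -> partial_perm) : hausdorff_space S ->
  (forall i, {morph phi i : x y / x * y}) -> (forall i, continuous (phi i)) ->
  (forall x O, nbhs x O -> exists J : seq (I * nat), forall s,
     (forall j, j \in J -> agree_at (phi j.1 x) j.2 (phi j.1 s)) -> O s) ->
  embeds_topologically S partial_perm.
Proof.
move=> hS phiM phiC phi_nbhs; pose Phi s := pp_sum (phi^~ s).
have Phi_nbhs x O : nbhs x O ->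
    exists F : seq nat, Phi @^-1` agree_on F (Phi x) `<=` O.
  move=> /phi_nbhs[J JO]; exists (map pickle J) => s xs.
  apply: JO => -[i a] iaJ; apply/(agree_at_sum (phi^~ x) (phi^~ s)).
  by apply: xs; exact: map_f.
exists Phi; apply/topological_embeddingP; split.
- move=> x y; rewrite /Phi -pp_sumM; congr pp_sum; apply/funext => i.
  exact: phiM.
- move=> x y xy; apply: hS => A B xA yB; exists y; split.
    by by have [F] := Phi_nbhs _ _ xA; apply; rewrite /= xy => a _ b.
  exact: nbhs_singleton.
- apply/pp_continuousP => t n.
  have [[[i a] nE]|nI] := pselect (exists ia : I * nat, n = pickle ia).
    rewrite nE; have := phiC i; move/pp_continuousP/(_ t a).
    by apply: filterS => s ts; apply/(agree_at_sum (phi^~ t) (phi^~ s)).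
  apply: filterS filterT => s _; apply: agree_at_sum_out => i a nE.
  by apply: nI; exists (i, a).
- move=> x O /Phi_nbhs[F FO]; exists (agree_on F (Phi x)) => //.
  exact: nbhs_agree_on.
Qed.

End Sum.

(** * Representations of the components of a Clifford semigroup *)

Definition pp_empty : partial_perm.
Proof. by exists set0. Defined.

Lemma pp_empty_mul h : pp_empty * h = pp_empty.
Proof. by apply: pp_eq; apply/seteqP; split=> -[a b] // [c []]. Qed.

Lemma pp_mul_empty h : h * pp_empty = pp_empty.
Proof. by apply: pp_eq; apply/seteqP; split=> -[a b] // [c []]. Qed.

(** An embedding of a subsemigroup, extended arbitrarily to a map on all of [S],
so that it can be composed with maps into [S] that land in the subsemigroup only
part of the time. *)
Lemma embeds_subsemigroup_ext (S : preTopologicalSemigroupType)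
    (B : subsemigroup S) (A := subsemigroup_set B) :
  embeds_topologically (subsemigroup_type B) partial_perm ->
  exists th : S -> partial_perm,
    [/\ forall x y, A x -> A y -> th (x * y) = th x * th y,
        forall x a, A x -> \forall y \near x, A y -> agree_at (th x) a (th y) &
        forall x O, A x -> nbhs x O -> exists F, forall y, A y ->
          agree_on F (th x) (th y) -> O y].
Proof.
move=> [phi /topological_embeddingP[phiM phiI phiC phi_nbhs]].
have /choice[th thE] : forall x, exists h, forall u : subsemigroup_type B,
    set_val u = x -> phi u = h.
  move=> x; have [Ax|nAx] := pselect (A x); last first.
    by exists pp_empty => u ux; case: nAx; rewrite -ux; exact: set_valP.
  exists (phi (SigSub (mem_set Ax))) => u ux.
  by congr phi; apply: val_inj.
have lift x : A x -> exists u : subsemigroup_type B, set_val u = x.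
  by move=> Ax; exists (SigSub (mem_set Ax)).
exists th; split.
- move=> _ _ /lift[u <-] /lift[v <-].
  by rewrite -(thE _ u erefl) -(thE _ v erefl) -(thE _ (u * v)) // phiM.
- move=> _ a /lift[u <-].
  have /nbhs_set_typeP[V uV VO] := phiC u _ (nbhs_agree_at (phi u) a).
  apply: filterS uV => _ /[swap] /lift[v <-] /VO.
  by rewrite -(thE _ u erefl) -(thE _ v erefl).
- move=> _ O /lift[u <-] uO.
  have /phi_nbhs[V /nbhs_ppP[F FV] VO] : nbhs u (set_val @^-1` O).
    by apply/nbhs_set_typeP; exists O.
  exists F => _ /lift[v <-].
  by rewrite -(thE _ u erefl) -(thE _ v erefl) => /FV/VO.
Qed.

(** Comparing the two sides of [sinv_comm] at [e * x] gives
[sinv x * e * x = e * (x * sinv x)]; multiplying by [x] on the left yields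
[x * e] on one side and [e * x] on the other. *)
Lemma idem_central (S : cliffordSemigroupType) (e x : S) :
  e * e = e -> e * x = x * e.
Proof.
move=> ee; set p := x * sinv x.
have pe : p * e = e * p by apply: idemC ee; exact: idem_mulgV.
have exe : sinv x * e * x = e * p.
  have -> : sinv x * e * x = sinv x * e * (e * x).
    by rewrite -!mulgA (mulgA e e) ee.
  have := sinv_comm (e * x); rewrite sinvM (sinv_idem ee) => <-.
  by transitivity (e * (p * e)); [rewrite /p !mulgA|rewrite pe mulgA ee].
transitivity (p * e * x); first by rewrite pe /p -mulgA mulgVKs.
transitivity (x * (sinv x * e * x)); first by rewrite /p !mulgA.
by rewrite exe -pe /p sinv_comm !mulgA mulgVKs.
Qed.

Lemma idem_mulgV_mul (S : cliffordSemigroupType) (x y : S) :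
  x * y * sinv (x * y) = x * sinv x * (y * sinv y).
Proof.
rewrite sinvM !mulgA -(mulgA x y) -(mulgA x) (idem_central _ (idem_mulgV y)).
by rewrite !mulgA.
Qed.

Section Translations.
Variable S : topologicalSemigroupType.

Lemma mulgl_continuous (e : S) : continuous (fun x : S => e * x).
Proof.
move=> x; apply: (@continuous_comp _ _ _ (fun x : S => (e, x))
  (fun xy : S * S => xy.1 * xy.2)); last exact: smul_continuous.
by apply: cvg_pair => //=; exact: cvg_cst.
Qed.

Lemma mulgr_continuous (e : S) : continuous (fun x : S => x * e).
Proof.
move=> x; apply: (@continuous_comp _ _ _ (fun x : S => (x, e))
  (fun xy : S * S => xy.1 * xy.2)); last exact: smul_continuous.
by apply: cvg_pair => //=; exact: cvg_cst.
Qed.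

End Translations.

(** Idempotents are partial identities, so they are compared on the diagonal. *)
Lemma agree_at_idem (g h : partial_perm) a : g * g = g -> h * h = h ->
  (pp_rel g (a, a) <-> pp_rel h (a, a)) -> agree_at g a h.
Proof.
move=> gg hh gh b.
have sub (k l : partial_perm) c d : k * k = k ->
    (pp_rel k (a, a) -> pp_rel l (a, a)) -> c = a \/ d = a ->
    pp_rel k (c, d) -> pp_rel l (c, d).
  move=> kk kl cda kcd; have cd := pp_idem_diag kk kcd; subst d.
  by case: cda kcd => -> /kl.
by split; split; apply: sub => //;
  (by left) || (by right) || (by move/gh).
Qed.

Section Components.
Variable S : cliffordTopologicalSemigroupType.
Implicit Types (e s t x : S) (O : set S).

(** The embedding of [E(S)] composed with the retraction of [S] onto [E(S)] that
sends [s] to [s * sinv s]. *)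
Lemma idempotent_component : continuous (@sinv S) ->
  embeds_topologically (idempotent_semilattice S) partial_perm ->
  exists eps : S -> partial_perm,
    [/\ {morph eps : x y / x * y}, continuous eps,
        forall s, eps (s * sinv s) = eps s &
        forall e O, e * e = e -> nbhs e O ->
          exists F, forall f, f * f = f -> agree_on F (eps e) (eps f) -> O f].
Proof.
move=> sinvC.
move=> /(@embeds_subsemigroup_ext S (idempotents S))[th [thM thC th_nbhs]].
have fE e : e * e = e -> e * sinv e = e by move=> ee; rewrite (sinv_idem ee).
exists (fun s => th (s * sinv s)); split.
- by move=> s t; rewrite idem_mulgV_mul thM //; exact: idem_mulgV.
- apply/pp_continuousP => t a.
  have domC : continuous (fun s : S => s * sinv s).
    move=> s; apply: (@continuous_comp _ _ _ (fun s : S => (s, sinv s))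
      (fun xy : S * S => xy.1 * xy.2)); last exact: smul_continuous.
    by apply: cvg_pair => //=; exact: sinvC.
  have : nbhs t ((fun s => s * sinv s) @^-1` [set u |
      idempotent_set S u -> agree_at (th (t * sinv t)) a (th u)]).
    exact/domC/thC/idem_mulgV.
  by apply: filterS => s; apply; exact: idem_mulgV.
- by move=> s; rewrite fE //; exact: idem_mulgV.
- move=> e O ee /th_nbhs[//|F FO]; exists F => f ff.
  by rewrite !fE //; exact: FO.
Qed.

(** Multiplication by [e] maps the part [P] of [S] into the maximal subgroup of
[e], multiplicatively since [e] is central.  Outside [P] the representation is
empty: it stays multiplicative because the complement of [P] is an ideal, and
continuous because [P] is clopen. *)
Lemma maximal_subgroup_component e (P : set S) : e * e = e ->
  embeds_topologically (subsemigroup_type (maximal_subgroup e)) partial_perm ->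
  (forall s t, P (s * t) <-> P s /\ P t) ->
  (forall s, \forall t \near s, P s <-> P t) ->
  (forall s, P s -> e * (s * sinv s) = e) ->
  exists phi : S -> partial_perm,
    [/\ {morph phi : x y / x * y}, continuous phi &
        forall x O, P x -> nbhs (e * x) O -> exists F, forall s, P s ->
          agree_on F (phi x) (phi s) -> O (e * s)].
Proof.
move=> ee /embeds_subsemigroup_ext[th [thM thC th_nbhs]] PM Pnear Pe.
have He s : P s -> subsemigroup_set (maximal_subgroup e) (e * s).
  move=> Ps; have ses : e * s * sinv (e * s) = e.
    by rewrite idem_mulgV_mul (sinv_idem ee) ee Pe.
  by split; rewrite -?sinv_comm.
exists (fun s => if `[< P s >] then th (e * s) else pp_empty); split.
- move=> s t; have [/PM[Ps Pt]|nP] := asboolP (P (s * t)).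
    rewrite !asboolT // -thM; [|exact: He..]; congr th.
    by rewrite !mulgA -(mulgA e s e) -(idem_central s ee) mulgA ee.
  have [Ps|nPs] := asboolP (P s); last by rewrite pp_empty_mul.
  have [Pt|nPt] := asboolP (P t); last by rewrite pp_mul_empty.
  by case: nP; apply/PM.
- apply/pp_continuousP => s a; have [Ps|nPs] := asboolP (P s).
    have near_s : nbhs s ((fun t => e * t) @^-1` [set u |
        subsemigroup_set (maximal_subgroup e) u ->
        agree_at (th (e * s)) a (th u)]).
      exact/mulgl_continuous/thC/He.
    apply: filterS (filterI (Pnear s) near_s) => t [sPt stP].
    by rewrite (asboolT (sPt.1 Ps)); apply: stP; exact/He/sPt.
  apply: filterS (Pnear s) => t sPt; rewrite asboolF //.
  by move=> /sPt.
- move=> x O Px /th_nbhs[|F FO]; first exact: He.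
  exists F => s Ps; rewrite !asboolT // => /FO; apply; exact: He.
Qed.

End Components.

(** The U-semilattice condition, read off in [S] rather than in the subspace of
idempotents. *)
Lemma U_semilattice_lower_bound (S : cliffordTopologicalSemigroupType) (e : S)
    (O : set S) :
  U_semilattice (idempotent_semilattice S) -> e * e = e -> nbhs e O ->
  exists y V, [/\ y * y = y, O y, nbhs e V &
    forall f, f * f = f -> V f -> y * f = y].
Proof.
rewrite {1}nbhsE => HU ee [O' [oO' O'e] O'O].
pose E := idempotent_semilattice S.
pose e' : E := SigSub (mem_set (ee : idempotent_set S e)).
have [|y [O'y [V [Ve' Vy]]]] := HU (set_val @^-1` O') e' _ O'e.
  by exists O'.
have /nbhs_set_typeP[W eW WV] := open_nbhs_nbhs Ve'.
exists (set_val y), W; split=> //; [exact: (set_valP y)|exact: O'O|].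
move=> f ff Wf; pose f' : E := SigSub (mem_set (ff : idempotent_set S f)).
by have := Vy f' (WV f' Wf) => /(congr1 set_val).
Qed.

(** * Assembling the components *)

Lemma embeds_of_components (S : cliffordTopologicalSemigroupType) :
  U_semilattice (idempotent_semilattice S) ->
  hausdorff_space S -> ditopological S ->
  (forall e : S, idempotent_set S e ->
     embeds_topologically (subsemigroup_type (maximal_subgroup e))
       partial_perm) ->
  embeds_topologically (idempotent_semilattice S) partial_perm ->
  embeds_topologically S partial_perm.
Proof.
move=> HU hS [sinvC ditop] Hemb Eemb.
have [eps [epsM epsC epsV eps_nbhs]] := idempotent_component sinvC Eemb.
have epsI s : eps s * eps s = eps s.
  by rewrite -(epsV s) -epsM idem_mulgV.
pose D s := [set a | pp_rel (eps s) (a, a)].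
have DM s t a : D (s * t) a <-> D s a /\ D t a.
  rewrite /D /= epsM; split=> [[b [/= sab tba]]|[sa ta]]; last by exists a.
  have ab := pp_idem_diag (epsI s) sab; by subst b.
have DP s t a : (D s a <-> D t a) -> agree_at (eps s) a (eps t).
  exact: agree_at_idem.
pose P (F : seq nat) := [set s | forall a, a \in F -> D s a].
(* The index [(F, K, L)] stands for the clopen part [P F] and the box of the
   idempotents [e] for which [D e] and [L] have the same elements in [K]. *)
pose good (k : seq nat * seq nat * seq nat) e :=
  [/\ e * e = e, forall a, a \in k.1.2 -> (D e a <-> a \in k.2) &
      forall s, P k.1.1 s -> e * (s * sinv s) = e].
(* Indices whose box has no lower bound of [P F] get a trivial
   representation. *)
have /choice[phi phiP] : forall k, exists phi : S -> partial_perm,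
    [/\ {morph phi : x y / x * y}, continuous phi &
      (exists e, good k e) -> exists2 e, good k e &
        forall x O, P k.1.1 x -> nbhs (e * x) O -> exists F, forall s,
          P k.1.1 s -> agree_on F (phi x) (phi s) -> O (e * s)].
  move=> k; have [[e ke]|nk] := pselect (exists e, good k e); last first.
    exists (fun=> pp_empty); split=> //; last exact: cst_continuous.
    by move=> s t; rewrite pp_empty_mul.
  have [ee _ kPe] := ke.
  have [||phi [phiM phiC phiP]] :=
      maximal_subgroup_component ee (Hemb e ee) _ _ kPe.
  - move=> s t; split=> [Pst|[Ps Pt] a aF].
      by split=> a /Pst/DM[].
    by apply/DM; split; [exact: Ps|exact: Pt].
  - move=> s; have near_s : nbhs s (eps @^-1` agree_on k.1.1 (eps s)).
      exact/epsC/nbhs_agree_on.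
    apply: filterS near_s => t st.
    by split=> Pa a aF; apply/(st a aF a).1; exact: Pa.
  by exists phi; split=> // _; exists e.
pose Phi (i : option _) := if i is Some k then phi k else eps.
apply: (@embeds_countable_family _ _ Phi hS).
- by case=> [k|] //; have [] := phiP k.
- by case=> [k|] //; have [] := phiP k.
move=> x O /ditop[U [W [xU xW UWO]]].
pose e := x * sinv x; have ee : e * e = e by exact: idem_mulgV.
move: xU; rewrite nbhsE => -[U' [oU' U'x] U'U].
have [K KWU] : exists K, forall f, f * f = f ->
    agree_on K (eps e) (eps f) -> W f /\ U' (f * x).
  apply: eps_nbhs => //; apply: filterI => //; apply: mulgr_continuous.
  by apply: open_nbhs_nbhs; split; rewrite // /e mulgVKs.
have eK : nbhs e (eps @^-1` agree_on K (eps e)) by exact/epsC/nbhs_agree_on.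
have [y [V [yy Ky eV Vy]]] := U_semilattice_lower_bound HU ee eK.
have [K' K'V] := eps_nbhs e V ee eV.
(* [K] cuts out the box in which [d] below is chosen, and [K'] a box around [e]
   all of whose members lie above [y]; dropping the negative conditions of [K'] leaves the filter given
   by [F], which still lies above [y]. *)
pose F := [seq a <- K' | `[< D e a >]].
pose k := (F, K, [seq a <- K | `[< D e a >]]).
have De a : D e a <-> D x a by rewrite /D /= epsV.
have good_y : good k y.
  split=> //= [a aK|s Ps].
    rewrite mem_filter aK andbT; split=> [yD|/asboolP eD].
      by apply/asboolP/(Ky a aK a).1.
    exact/(Ky a aK a).1.
  set f := s * sinv s; have ff : f * f = f by exact: idem_mulgV.
  have yfe : y * (f * e) = y.
    apply: Vy; first exact: idemM.
    apply: K'V => [|a aK']; first exact: idemM.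
    apply: DP; split=> [eD|/DM[]//]; apply/DM; split=> //.
    rewrite /D /= epsV; apply: Ps; rewrite mem_filter aK' andbT.
    exact/asboolP.
  rewrite -{1}yfe -mulgA -(mulgA f) (idemC ee ff) (mulgA f) ff.
  exact: yfe.
(* The element [y] only shows that the index [k] is good; the representation
   [phi k] is built on some other [d] from the same box. *)
have [phiM phiC /(_ (ex_intro _ _ good_y))[d [dd Kd Pd] phi_nbhs]] := phiP k.
have [Wd U'd] : W d /\ U' (d * x).
  apply: KWU => // a aK; apply: DP.
  split=> [eD|/(Kd a aK).1]; last by rewrite mem_filter => /andP[/asboolP].
  by apply/(Kd a aK); rewrite mem_filter aK andbT; apply/asboolP.
have Px : P F x.
  by move=> a; rewrite mem_filter => /andP[/asboolP/De].
have [F' F'U] := phi_nbhs x U' Px (open_nbhs_nbhs (conj oU' U'd)).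
exists ([seq (None, a) | a <- K ++ F] ++ [seq (Some k, a) | a <- F']) => s xs.
have sE a : a \in K ++ F -> agree_at (eps x) a (eps s).
  by move=> aKF; apply: (xs (None, a)); rewrite mem_cat map_f.
have sk a : a \in F' -> agree_at (phi k x) a (phi k s).
  by move=> aF'; apply: (xs (Some k, a)); rewrite mem_cat orbC map_f.
apply: UWO; split.
  exists (d * s); split; last by exists d.
  apply/U'U/F'U => // a aF; apply/(sE a _ a).1; last exact: Px.
  by rewrite mem_cat aF orbT.
have [] // := KWU (s * sinv s) (idem_mulgV s).
move=> a aK; rewrite !epsV; apply: sE; by rewrite mem_cat aK.
Qed.

Theorem theorem2p11 (S : cliffordTopologicalSemigroupType)
    (HU : U_semilattice (idempotent_semilattice S)) :
  embeds_topologically S partial_perm <->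
  [/\ hausdorff_space S,
      ditopological S,
      (forall e : S, idempotent_set S e ->
         embeds_topologically (subsemigroup_type (maximal_subgroup e))
           partial_perm) &
      embeds_topologically (idempotent_semilattice S) partial_perm].
Proof.
split=> [Semb|[hS ditop Hemb Eemb]]; last exact: embeds_of_components.
split=> [|||].
- exact: embeds_hausdorff Semb hausdorff_partial_perm.
- exact: embeds_ditopological.
- by move=> e _; exact: embeds_subsemigroup.
- exact: (embeds_subsemigroup (idempotents S) Semb).
Qed.
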